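(* Let $n\ge 3$, let $a_0,\ldots,a_{n-1}$ be indeterminates over $\mathbb{Q}$, $f=x^n+a_{n-1}x^{n-1}+\cdots+a_0$, and let \[f_1(x,y)=\frac{f(y)-f(x)}{y-x},\qquad f_3(x,y)=\frac{f(y)-2f\left(\frac{x+y}{2}\right)+f(x)}{\frac{(y-x)^2}{2}},\] $F=\operatorname{res}(f_1,f_3,y)$ and $E=\operatorname{res}(f,F,x)\in\mathbb{Q}[a_0,\ldots,a_{n-1}]$. Let $D_2\in\mathbb{Q}[a_0,\ldots,a_{n-1}]$ be the polynomial obtained by expressing $\prod_{1\le i,j,k\le n,\ i<j,\ j\ne k,\ k\ne i}(2r_k-r_i-r_j)$, where $r_1,\ldots,r_n$ are the roots of $f$, in terms of $a_0,\ldots,a_{n-1}$ via Vieta's formulas. Then $E=c\,D_2^2$ for some nonzero rational number $c$.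
   Context: The quotients defining $f_1,f_3$ are polynomials in $x,y$; $\operatorname{res}$ denotes the Sylvester resultant with respect to the indicated variable. *)

(* Defs.v *)
From HB Require Import structures.
From mathcomp Require Import all_boot all_order all_algebra.
From mathcomp Require Import mpoly.
Set Implicit Arguments. Unset Strict Implicit. Unset Printing Implicit Defensive.
Import Order.TTheory GRing.Theory Num.Theory.
Local Open Scope ring_scope.

(* Coefficient ring Q[a_0, ..., a_{n-1}]: the variable a_i is 'X_i. *)
Notation Acoef n := {mpoly rat[n]}.

Definition fgen (n : nat) : {poly Acoef n} :=
  'X^n + \sum_(i < n) ('X_i)%:P * 'X^i.

(* Bivariate polynomials in Q[a][x][y]: outer variable y, inner variable x.
   Xb = x, Yb = y. *)
Definition Xb (n : nat) : {poly {poly Acoef n}} := ('X)%:P.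
Definition Yb (n : nat) : {poly {poly Acoef n}} := 'X.

Definition fbiv (n : nat) (q : {poly {poly Acoef n}}) : {poly {poly Acoef n}} :=
  map_poly (fun c => c%:P) (fgen n) \Po q.

(* f_1(x,y) = (f(y) - f(x)) / (y - x); the division is exact (divisor monic in y). *)
Definition f1 (n : nat) : {poly {poly Acoef n}} :=
  (fbiv (Yb n) - fbiv (Xb n)) %/ (Yb n - Xb n).

(* f_3(x,y) = (f(y) - 2 f((x+y)/2) + f(x)) / ((y-x)^2/2); exact division
   (written as 2 * (numerator %/ (y-x)^2), divisor monic in y). *)
Definition f3 (n : nat) : {poly {poly Acoef n}} :=
  (fbiv (Yb n) - 2%:R * fbiv ((Xb n + Yb n) * (2%:R)^-1%:P%:P) + fbiv (Xb n))
    %/ ((Yb n - Xb n) ^+ 2) * 2%:R.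

Definition Fres (n : nat) : {poly Acoef n} := resultant (f1 n) (f3 n).
Definition Eres (n : nat) : Acoef n := resultant (fgen n) (Fres n).

(* Roots r_1..r_n are the variables of Q[r_0..r_{n-1}] = {mpoly rat[n]}.
   The product  prod_{i<j, k <> i, k <> j} (2 r_k - r_i - r_j). *)
Definition D2roots (n : nat) : {mpoly rat[n]} :=
  \prod_(i < n) \prod_(j < n | (i < j)%N)
     \prod_(k < n | (k != i) && (k != j)) (2%:R *: 'X_k - 'X_i - 'X_j).

(* Vieta: with f = prod (x - r_i), a_i = (-1)^(n-i) e_{n-i}(r). *)
Definition vieta (n : nat) : n.-tuple {mpoly rat[n]} :=
  [tuple ((-1) ^+ (n - i) *: mesym n rat (n - i)) | i < n].

Definition via_vieta (n : nat) (p : Acoef n) : {mpoly rat[n]} :=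
  comp_mpoly (vieta n) p.

(* Main.v *)
Require Import Defs.
From HB Require Import structures.
From mathcomp Require Import all_boot all_order all_algebra all_fingroup.
From mathcomp Require Import ring mpoly.
Set Implicit Arguments. Unset Strict Implicit. Unset Printing Implicit Defensive.
Import Order.TTheory GRing.Theory Num.Theory.
Local Open Scope ring_scope.

(* Substituting Vieta's formulas embeds Q[a] into Q[r], where f splits as
   prod_j (x - r_j), so the identity may be checked there. For a monic p with
   distinct roots, res(p, q) is up to sign the product of the values of q at the
   roots of p: multiply the Sylvester matrix by the matrix of the functionals
   "value at a root" and "coefficient of a high power of X". This formula needs
   no information on the degree of q, hence specializes freely. Applied twice it
   gives E = +- prod_{i <> j} f_3(r_i, r_j). As f vanishes at r_i and r_j, only
   the midpoint term of f_3 survives, and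
     f_3(r_i, r_j) = (-1/2)^(n-2) prod_{k <> i,j} (2 r_k - r_i - r_j).
   Each unordered pair {i, j} is counted twice, whence the square of D_2. *)

(** * The resultant as a product over the roots *)

Section ShiftedRowsDet.

Variables (R : idomainType) (m : nat) (rs : seq R).
Variables (P Q : {poly R}).
Let k := size rs.
Hypothesis P_split : P = \prod_(x <- rs) ('X - x%:P).
Hypothesis uniq_rs : uniq rs.
Hypothesis size_Q : (size Q <= m.+1)%N.

(** These are the Sylvester rows read as polynomials. As [m] merely bounds the degree of [Q], that
    degree may drop under a specialization. *)
Let T (i : 'I_(m + k)) : {poly R} :=
  match split i with inl i0 => P * 'X^i0 | inr i0 => Q * 'X^i0 end.

Let size_P : size P = k.+1.
Proof. by rewrite P_split size_prod_XsubC. Qed.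

Let size_T i : (size (T i) <= m + k)%N.
Proof.
rewrite /T; case: (split i) => i0; apply: (leq_trans (size_polyMleq _ _));
  rewrite size_polyXn addnS /=.
  by rewrite size_P addSnnS addnC leq_add2r.
apply: (leq_trans (leq_add size_Q (leqnn _))).
by rewrite addSnnS leq_add2l.
Qed.

Let rot_ord_subproof (i : 'I_(m + k)) : ((i + k) %% (m + k) < m + k)%N.
Proof. by rewrite ltn_mod (leq_ltn_trans (leq0n i)). Qed.

(** This rotation of the rows of the matrix [W] below moves the powers below [k] to the bottom,
    where they form the Vandermonde block. *)
Let rot_ord (i : 'I_(m + k)) := Ordinal (rot_ord_subproof i).

Let rot_ord_inj : injective rot_ord.
Proof.
move=> i j /(congr1 val) /= /eqP; rewrite eqn_modDr !modn_small // => /eqP.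
exact: val_inj.
Qed.

Let rot_lshift i : rot_ord (lshift k i) = (k + i)%N :> nat.
Proof. by rewrite /= modn_small ?ltn_add2r // addnC. Qed.

Let rot_rshift (i : 'I_k) : rot_ord (rshift m i) = i :> nat.
Proof.
rewrite /= addnAC addnC modnDr modn_small //.
exact: leq_trans (ltn_ord i) (leq_addl _ _).
Qed.

Let a : 'rV[R]_k := \row_j rs`_j.

(* Columns are linear functionals on polynomials of size at most m + k:
   the coefficients of X^k, ..., X^(k+m-1), then the values at the roots. *)
Let W : 'M[R]_(m + k) := \matrix_(i, j)
  match split j with inl j0 => (i == k + j0 :> nat)%:R | inr j0 => rs`_j0 ^+ i end.

Let W_det : \det W = (-1) ^+ perm rot_ord_inj * \det (Vandermonde k a).
Proof.
pose s := perm rot_ord_inj.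
have -> : \det (Vandermonde k a) = \det (row_perm s W).
  have -> : row_perm s W
      = block_mx 1%:M (ursubmx (row_perm s W)) 0 (Vandermonde k a).
    rewrite -[LHS]submxK; congr block_mx; apply/matrixP=> i j.
    - rewrite !mxE (unsplitK (inl _)) permE rot_lshift eqn_add2l.
      by rewrite -val_eqE.
    - rewrite !mxE (unsplitK (inl _)) permE rot_rshift.
      by rewrite ltn_eqF // (leq_trans (ltn_ord i)) ?leq_addr.
    - by rewrite !mxE (unsplitK (inr _)) permE rot_rshift.
  by rewrite det_ublock det1 mul1r.
by rewrite row_permE det_mulmx det_perm mulrA -signr_addb addbb mul1r.
Qed.

Let V_neq0 : \det (Vandermonde k a) != 0.
Proof.
rewrite det_Vandermonde; apply/prodf_neq0 => i _; apply/prodf_neq0 => j ltij.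
by rewrite !mxE subr_eq0 nth_uniq // gtn_eqF.
Qed.

(** [M *m W] is block lower triangular, since [P] vanishes at its roots. Its diagonal blocks are
    unitriangular and Vandermonde times the diagonal of the values of [Q]; the nonzero Vandermonde
    determinant then cancels. *)
Lemma det_shifted_rows (M : 'M[R]_(m + k)) :
    (forall i j, M i j = (T i)`_j) ->
  exists b : bool, \det M = (-1) ^+ b * \prod_(x <- rs) Q.[x].
Proof.
move=> ME; exists (perm rot_ord_inj); apply: (mulIf V_neq0).
have : \det M * \det W = \det (Vandermonde k a) * \prod_(x <- rs) Q.[x].
  rewrite -det_mulmx.
  have MWl i (j : 'I_m) : (M *m W) i (lshift k j) = (T i)`_(k + j).
    have ltkj : (k + j < m + k)%N by rewrite addnC ltn_add2r.
    rewrite mxE (bigD1 (Ordinal ltkj)) //= big1 => [|l neq_l].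
      by rewrite addr0 ME mxE (unsplitK (inl _)) /= eqxx mulr1.
    by rewrite mxE (unsplitK (inl _)) /= -val_eqE /= in neq_l *;
       rewrite (negPf neq_l) mulr0.
  have MWr i (j : 'I_k) : (M *m W) i (rshift m j) = (T i).[rs`_j].
    rewrite mxE (horner_coef_wide _ (size_T i)); apply: eq_bigr => l _.
    by rewrite ME mxE (unsplitK (inr _)).
  have -> : M *m W = block_mx (ulsubmx (M *m W)) 0 (dlsubmx (M *m W))
      (Vandermonde k a *m diag_mx (\row_j Q.[rs`_j])).
    rewrite -[LHS]submxK; congr block_mx; apply/matrixP=> i j.
    - rewrite 2!mxE MWr /T (unsplitK (inl _)) hornerM P_split mxE.
      have /eqP -> : root (\prod_(x <- rs) ('X - x%:P)) rs`_j.
        by rewrite root_prod_XsubC mem_nth.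
      by rewrite mul0r.
    - rewrite 2!mxE MWr /T (unsplitK (inr _)) hornerM hornerXn.
      by rewrite mul_mx_diag !mxE mulrC.
  rewrite det_lblock det_mulmx det_diag det_trig; last first.
    (* For [i < j], the degree [k + j] exceeds that of [P * 'X^i]. *)
    apply/is_trig_mxP => i j ltij; rewrite 2!mxE MWl /T (unsplitK (inl _)).
    rewrite coefMXn; case: ifP => // _; apply: nth_default.
    by rewrite size_P -addnBA ?(ltnW ltij) // -addn1 leq_add2l subn_gt0.
  rewrite big1 ?mul1r => [|i _]; last first.
    rewrite 2!mxE MWl /T (unsplitK (inl _)) coefMXn ltnNge leq_addl /= addnK.
    have /monicP : P \is monic by rewrite P_split monic_prod_XsubC.
    by rewrite lead_coefE size_P.
  congr (_ * _); rewrite (big_nth 0) big_mkord; apply: eq_bigr => i _.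
  by rewrite mxE.
rewrite W_det => eqMW.
rewrite -mulrA [X in _ = _ * X]mulrC -eqMW [RHS]mulrCA; congr (_ * _).
by rewrite mulrA -signr_addb addbb mul1r.
Qed.

End ShiftedRowsDet.

(** The Sylvester matrix is specialized entrywise and keeps its size, even if [q] loses degree under
    [phi]. *)
Lemma rmorph_resultant_roots (R : comNzRingType) (S : idomainType)
    (phi : {rmorphism R -> S}) (p q : {poly R}) (rs : seq S) :
    p \is monic -> uniq rs -> map_poly phi p = \prod_(x <- rs) ('X - x%:P) ->
  exists b : bool,
    phi (resultant p q) = (-1) ^+ b * \prod_(x <- rs) (map_poly phi q).[x].
Proof.
move=> p_monic uniq_rs p_split.
have size_rs : size rs = (size p).-1.
  apply: succn_inj; rewrite -(size_prod_XsubC _ id) /= -p_split.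
  rewrite size_map_poly_id0 ?(monicP p_monic) ?rmorph1 ?oner_eq0 //.
  by rewrite prednK // size_poly_gt0 monic_neq0.
have size_q : (size (map_poly phi q) <= (size q).-1.+1)%N.
  exact: leq_trans (size_poly _ _) (leqSpred _).
rewrite /resultant -det_map_mx.
(* The matrix is generalized with its entry formula, so that its dimension can be rewritten in terms
   of [size rs]. *)
move: (Sylvester_mx p q) (@Sylvester_mxE R p q); rewrite -size_rs => S0 S0E.
apply: (det_shifted_rows p_split uniq_rs size_q) => i j.
rewrite mxE S0E; case: (split i) => i0; rewrite coefMXn ltnNge coef_map;
  by case: leqP => _; rewrite ?mulr1n ?mulr0n ?rmorph0.
Qed.

(** * Square and symmetry of the root product *)

Definition D2factor n (i j : 'I_n) : {mpoly rat[n]} :=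
  \prod_(k < n | (k != i) && (k != j)) (2%:R *: 'X_k - 'X_i - 'X_j).

Lemma D2factorC n (i j : 'I_n) : D2factor i j = D2factor j i.
Proof. by apply: eq_big => [k|k _]; [rewrite andbC | rewrite addrAC]. Qed.

Lemma D2rootsE n :
  D2roots n = \prod_(p : 'I_n * 'I_n | (p.1 < p.2)%N) D2factor p.1 p.2.
Proof. by rewrite /D2roots pair_big_dep. Qed.

(** Ordered pairs split into [i < j] and [j < i]; the swap identifies the two halves because
    [D2factor] is symmetric. *)
Lemma sqr_D2roots n :
  D2roots n ^+ 2 = \prod_(i < n) \prod_(j < n | j != i) D2factor i j.
Proof.
rewrite pair_big_dep /= (bigID (fun p : 'I_n * 'I_n => (p.1 < p.2)%N)) /=.
rewrite expr2 D2rootsE.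
congr (_ * _).
  by apply: eq_bigl => -[i j] /=; rewrite -val_eqE /=; case: ltngtP.
rewrite (reindex_inj (h := fun p : 'I_n * 'I_n => (p.2, p.1))) /=; last first.
  by move=> [? ?] [? ?] [-> ->].
apply: eq_big => [[i j]|[i j] _] /=; last exact: D2factorC.
by rewrite -val_eqE /=; case: ltngtP.
Qed.

Lemma msym_D2factor n (s : {perm 'I_n}) (i j : 'I_n) :
  msym s (D2factor i j) = D2factor (s i) (s j).
Proof.
rewrite rmorph_prod /= [RHS](reindex_inj (@perm_inj _ s)) /=.
apply: eq_big => [k|k _]; first by rewrite !(inj_eq perm_inj).
have msymXU l : msym s 'X_l = 'X_(s l) :> {mpoly rat[n]}.
  by rewrite /msym mmapX mmap1U.
by rewrite !rmorphB /= msymZ !msymXU.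
Qed.

(** A permutation of the roots permutes unordered pairs. Each is represented by its increasing pair,
    so the action has to sort again. *)
Lemma D2roots_sym n : D2roots n \is symmetric.
Proof.
apply/issymP => s; rewrite D2rootsE rmorph_prod /=.
pose sorted_pair (p : 'I_n * 'I_n) := if (p.1 < p.2)%N then p else (p.2, p.1).
pose act (t : {perm 'I_n}) p := sorted_pair (t p.1, t p.2).
have actK (t : {perm 'I_n}) (p : 'I_n * 'I_n) :
    (p.1 < p.2)%N -> act t^-1%g (act t p) = p.
  case: p => i j /= ltij; rewrite /act /sorted_pair /=.
  by case: (t i < t j)%N => /=; rewrite !permK ?ltij // ltnNge (ltnW ltij).
have act_lt (t : {perm 'I_n}) (p : 'I_n * 'I_n) :
    (p.1 < p.2)%N -> ((act t p).1 < (act t p).2)%N.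
  case: p => i j /= ltij; rewrite /act /sorted_pair /=.
  case: (ltngtP (t i) (t j)) => //= eq_t.
  by move: ltij; rewrite (perm_inj (val_inj eq_t)) ltnn.
rewrite [RHS](reindex_onto (act s) (act s^-1%g)) /=; last first.
  by move=> p /(actK s^-1%g); rewrite invgK.
apply: eq_big => [p|[i j] _].
  apply/idP/andP => [ltp|[lt_act /eqP <-]]; last exact: act_lt.
  by rewrite actK // eqxx act_lt.
rewrite msym_D2factor /act /sorted_pair /=; case: ifP => //= _; exact: D2factorC.
Qed.

(** * Vieta's substitution *)

(* Reversal and signs turn the elementary symmetric polynomials e_1, ..., e_n
   into the coefficients given by Vieta's formulas, and conversely. *)
Definition signed_rev n : n.-tuple {mpoly rat[n]} :=
  [tuple (-1) ^+ (n - i) *: 'X_(rev_ord i) | i < n].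

Definition signed_rev_inv n : n.-tuple {mpoly rat[n]} :=
  [tuple (-1) ^+ i.+1 *: 'X_(rev_ord i) | i < n].

Lemma comp_mpolyA n k l (R : comNzRingType) (p : {mpoly R[n]})
    (t : n.-tuple {mpoly R[k]}) (u : k.-tuple {mpoly R[l]}) :
  (p \mPo t) \mPo u = p \mPo [tuple tnth t i \mPo u | i < n].
Proof.
rewrite [p \mPo t]comp_mpolyEX [RHS]comp_mpolyEX raddf_sum /=.
apply: eq_bigr => m _; rewrite comp_mpolyZ !comp_mpolyX rmorph_prod /=.
by congr (_ *: _); apply: eq_bigr => i _; rewrite rmorphXn tnth_mktuple.
Qed.

Lemma rev_ord_sub n (i : 'I_n) : (n - rev_ord i)%N = i.+1.
Proof. by rewrite /= subKn. Qed.

Lemma vieta_mesym n (p : {mpoly rat[n]}) :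
  via_vieta p = (p \mPo signed_rev n) \mPo [tuple mesym n rat i.+1 | i < n].
Proof.
rewrite comp_mpolyA; congr (_ \mPo _); apply: eq_from_tnth => i.
rewrite !tnth_mktuple comp_mpolyZ comp_mpolyXU -tnth_nth tnth_mktuple.
by rewrite /= subnSK.
Qed.

Lemma signed_revK n :
  cancel (comp_mpoly (signed_rev n)) (comp_mpoly (signed_rev_inv n)).
Proof.
move=> p; rewrite comp_mpolyA -[RHS]comp_mpoly_id; congr (_ \mPo _).
apply: eq_from_tnth => i; rewrite !tnth_mktuple comp_mpolyZ comp_mpolyXU.
rewrite -tnth_nth tnth_mktuple rev_ordK scalerA /= -subSn // subSS.
by rewrite -exprD addnn -signr_odd odd_double scale1r.
Qed.

Lemma signed_rev_invK n :
  cancel (comp_mpoly (signed_rev_inv n)) (comp_mpoly (signed_rev n)).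
Proof.
move=> p; rewrite comp_mpolyA -[RHS]comp_mpoly_id; congr (_ \mPo _).
apply: eq_from_tnth => i; rewrite !tnth_mktuple comp_mpolyZ comp_mpolyXU.
rewrite -tnth_nth tnth_mktuple rev_ordK scalerA rev_ord_sub.
by rewrite -exprD addnn -signr_odd odd_double scale1r.
Qed.

(** This is the algebraic independence of the elementary symmetric polynomials, transported along
    the invertible [signed_rev]. *)
Lemma via_vieta_inj n : injective (@via_vieta n).
Proof.
move=> p q; rewrite !vieta_mesym => /msym_fundamental_un.
exact: can_inj (@signed_revK n) _ _.
Qed.

Lemma via_vieta_sym n (p : {mpoly rat[n]}) :
  p \is symmetric -> exists q, via_vieta q = p.
Proof.
move=> /sym_fundamental [t [<- _]]; exists (t \mPo signed_rev_inv n).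
by rewrite vieta_mesym signed_rev_invK.
Qed.

Lemma map_fgen n :
  map_poly (comp_mpoly (vieta n)) (fgen n) = \prod_(i < n) ('X - ('X_i)%:P).
Proof.
pose cs := [tuple ('X_i : {mpoly rat[n]}) | i < n].
have -> : \prod_(i < n) ('X - ('X_i)%:P) = \prod_(c <- cs) ('X - c%:P).
  by rewrite big_tuple; apply: eq_bigr => i _; rewrite tnth_mktuple.
(* [mroots_coeff] evaluates [mesym] at the tuple of roots; at the tuple of variables this gives
   [mesym] back. *)
have mesym_cs k : (mesym n _ k).@[tnth cs] = mesym n rat k.
  rewrite /mesym rmorph_sum /=; apply: eq_bigr => h _; rewrite rmorph_prod /=.
  by apply: eq_bigr => i _; rewrite mevalXU tnth_mktuple.
have sz : size (\prod_(c <- cs) ('X - c%:P)) = n.+1.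
  by rewrite size_prod_XsubC size_tuple.
have cs_monic : \prod_(c <- cs) ('X - c%:P) \is monic by exact: monic_prod_XsubC.
rewrite -[RHS]coefK sz poly_def big_ord_recr /= addrC.
have := monicP cs_monic; rewrite lead_coefE sz /= => ->; rewrite scale1r.
rewrite /fgen rmorphD rmorphXn /= map_polyX; congr (_ + _).
rewrite rmorph_sum; apply: eq_bigr => i _ /=.
rewrite rmorphM rmorphXn /= map_polyX map_polyC /= -mul_polyC; congr (_%:P * _).
rewrite comp_mpolyXU -tnth_nth tnth_mktuple.
have lt_ni : (n - i < n.+1)%N by rewrite ltnS leq_subr.
have := mroots_coeff cs (Ordinal lt_ni).
rewrite /= subKn ?(ltnW (ltn_ord i)) // => ->.
by rewrite mesym_cs -mul_mpolyC rmorphXn rmorphN1.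
Qed.

(** * Exactness of the quotients defining $f_1$ and $f_3$ *)

(** The linear coefficient [b] is chosen before [h], so the same one serves the steps [h] and
    [- h]. *)
Lemma horner_taylor2 (R : comNzRingType) (p : {poly R}) (x : R) :
  exists b : R, forall h, exists c, p.[x + h] = p.[x] + h * b + c * h ^+ 2.
Proof.
elim/poly_ind: p => [|p a [b IH]].
  by exists 0 => h; exists 0; rewrite !horner0; ring.
exists (p.[x] + x * b) => h; have [c Ec] := IH h.
by exists (b + c * (x + h)); rewrite !hornerMXaddC Ec; ring.
Qed.

Lemma horner_sub_factor (R : comNzRingType) (p : {poly R}) (x y : R) :
  exists c, p.[y] - p.[x] = c * (y - x).
Proof.
have [b /(_ (y - x)) [c]] := horner_taylor2 p x; rewrite addrC subrK => ->.
by exists (b + c * (y - x)); ring.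
Qed.

Lemma horner_midpoint_factor (R : comNzRingType) (p : {poly R}) (x y h : R) :
    h * 2%:R = 1 ->
  exists c, p.[y] - 2%:R * p.[(x + y) * h] + p.[x] = c * (y - x) ^+ 2.
Proof.
move=> h2; set z := (x + y) * h; set e := (y - x) * h.
have -> : y = z + e by rewrite -[LHS]mulr1 -h2 /z /e; ring.
have -> : x = z + - e by rewrite -[LHS]mulr1 -h2 /z /e; ring.
have [b tp] := horner_taylor2 p z.
(* Expanding at the midpoint with steps [e] and [- e] cancels the linear terms. *)
have [c ->] := tp e; have [c' ->] := tp (- e).
exists ((c + c') * h ^+ 2).
by transitivity ((c + c') * (h * 2%:R) ^+ 2 * e ^+ 2); [rewrite h2|]; ring.
Qed.

(** With equality up to a nonzero constant, the powers of $-1/2$ need not be tracked. *)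
Lemma prod_scaled (F : fieldType) (A : comAlgType F) (I : Type) (r : seq I)
    (P : pred I) (u v : I -> A) :
    (forall i, P i -> exists2 c : F, c != 0 & u i = c *: v i) ->
  exists2 c : F, c != 0 &
    \prod_(i <- r | P i) u i = c *: \prod_(i <- r | P i) v i.
Proof.
move=> uv; apply: (big_ind2 (fun x y => exists2 c : F, c != 0 & x = c *: y)) => //.
- by exists 1; rewrite ?oner_eq0 ?scale1r.
- move=> x1 x2 y1 y2 [c nz_c ->] [d nz_d ->]; exists (c * d); first exact: mulf_neq0.
  by rewrite -scalerAl -scalerAr scalerA.
Qed.

Lemma mpoly_inv2_mul2 n : (2%:R^-1)%:MP_[n] * 2%:R = 1 :> {mpoly rat[n]}.
Proof.
have -> : 2%:R = (2%:R)%:MP :> {mpoly rat[n]} by rewrite rmorph_nat.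
by rewrite -rmorphM /= mulVf // rmorph1.
Qed.

(** [f3] inverts 2 inside the polynomial ring; as 2 is a unit there, the result is the constant
    $1/2$ and not a default value. *)
Lemma mpoly_inv2 n : 2%:R^-1 = (2%:R^-1)%:MP_[n] :> {mpoly rat[n]}.
Proof. by apply: mulr1_eq; rewrite mulrC mpoly_inv2_mul2. Qed.

Lemma fbivE n (q : {poly {poly Acoef n}}) :
  fbiv q = (map_poly (polyC \o polyC) (fgen n)).[q].
Proof. by rewrite /fbiv /comp_poly -map_poly_comp. Qed.

(** The product form passes through any ring morphism, whereas [%/] need not. *)
Lemma f1_mul n : f1 n * (Yb n - Xb n) = fbiv (Yb n) - fbiv (Xb n).
Proof.
rewrite /f1 !fbivE; set g := map_poly _ _.
have [c ->] := horner_sub_factor g (Xb n) (Yb n).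
rewrite Pdiv.IdomainUnit.mulpK //.
by rewrite /Yb /Xb lead_coefXsubC unitr1.
Qed.

Lemma f3_mul n : f3 n * (Yb n - Xb n) ^+ 2 =
  (fbiv (Yb n) - 2%:R * fbiv ((Xb n + Yb n) * (2%:R)^-1%:P%:P) + fbiv (Xb n)) * 2%:R.
Proof.
rewrite /f3 !fbivE; set g := map_poly _ _; set h := _%:P%:P.
have h2 : h * 2%:R = 1.
  have -> : 2%:R = (2%:R : Acoef n)%:P%:P by rewrite !rmorph_nat.
  by rewrite /h -!rmorphM /= mpoly_inv2 mpoly_inv2_mul2 !rmorph1.
have [c ->] := horner_midpoint_factor g (Xb n) (Yb n) h2.
rewrite Pdiv.IdomainUnit.mulpK; first by rewrite mulrAC.
by rewrite lead_coef_exp /Yb /Xb lead_coefXsubC expr1n unitr1.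
Qed.

(** * Quotients of a split polynomial at its roots *)

Section SplitPolynomial.

Variables (R : idomainType) (I : finType) (r : I -> R).
Local Notation f := (\prod_i ('X - (r i)%:P)).

Lemma split_poly_root i : f.[r i] = 0.
Proof. by rewrite horner_prod (bigD1 i) //= hornerXsubC subrr mul0r. Qed.

Lemma split_poly_divided_difference i (g : {poly R}) :
    g * ('X - (r i)%:P) = f - (f.[r i])%:P ->
  g = \prod_(j | j != i) ('X - (r j)%:P).
Proof.
rewrite split_poly_root subr0 (bigD1 i) //= mulrC => /mulfI; apply.
by rewrite polyXsubC_eq0.
Qed.

(** Only $-4f$ at the midpoint survives. The factors of $f$ at [i] and [j] contribute
    $-(r_j-r_i)^2/4$ there, which cancels the denominator. *)
Lemma split_poly_midpoint_value i j (h v : R) :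
    h * 2%:R = 1 -> i != j -> r i != r j ->
    v * (r j - r i) ^+ 2 = (f.[r j] - 2%:R * f.[(r i + r j) * h] + f.[r i]) * 2%:R ->
  v = \prod_(k | (k != i) && (k != j)) (- h * (2%:R * r k - r i - r j)).
Proof.
move=> h2 neq_ij neq_r; rewrite !split_poly_root add0r addr0 horner_prod.
rewrite (bigD1 i) //= (bigD1 j) ?(eq_sym j) //= !hornerXsubC.
have -> : \prod_(k | (k != i) && (k != j)) ('X - (r k)%:P).[(r i + r j) * h]
    = \prod_(k | (k != i) && (k != j)) (- h * (2%:R * r k - r i - r j)).
  apply: eq_bigr => k _; rewrite hornerXsubC.
  by have {1}-> : r k = r k * (h * 2%:R) by [rewrite h2 mulr1]; ring.
move: (\prod_(k | _) _) => w Ev.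
have nz_d : (r j - r i) ^+ 2 != 0 by rewrite expf_neq0 // subr_eq0 eq_sym.
apply: (mulIf nz_d); rewrite {}Ev.
have Ei : (r i + r j) * h - r i = (r j - r i) * h.
  by rewrite -[X in _ - X]mulr1 -h2; ring.
have Ej : (r i + r j) * h - r j = - ((r j - r i) * h).
  by rewrite -[X in _ - X]mulr1 -h2; ring.
rewrite Ei Ej.
by transitivity (w * (r j - r i) ^+ 2 * (h * 2%:R) ^+ 2); [ring | rewrite h2; ring].
Qed.

End SplitPolynomial.

(** * Specialization of $f_1$ and $f_3$ at the roots *)

Lemma mpolyXU_inj n : injective (fun i : 'I_n => 'X_i : {mpoly rat[n]}).
Proof.
move=> i j /(congr1 (mcoeff U_(j))) /eqP; rewrite !mcoeffX eqxx eq_mnm1.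
by case: (i =P j) => // _; rewrite eq_sym oner_eq0.
Qed.

Section RmorphExpressions.

Variables (A B : comNzRingType) (phi : {rmorphism A -> B}) (a b c : A).

Lemma rmorph_mul_sqrB : phi (a * (b - c) ^+ 2) = phi a * (phi b - phi c) ^+ 2.
Proof. by rewrite rmorphM rmorphXn rmorphB. Qed.

Lemma rmorph_mulD : phi ((a + b) * c) = (phi a + phi b) * phi c.
Proof. by rewrite rmorphM rmorphD. Qed.

Lemma rmorph_midpoint_difference :
  phi ((a - 2%:R * b + c) * 2%:R) = (phi a - 2%:R * phi b + phi c) * 2%:R.
Proof. by rewrite rmorphM rmorphD rmorphB rmorphM rmorph_nat. Qed.

End RmorphExpressions.

Section Specialization.

Variables (n : nat) (i : 'I_n).

(** Being a ring morphism on the coefficients in $y$, it can be applied inside the resultant with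
    respect to $y$. *)
Definition spec_x : {poly Acoef n} -> {mpoly rat[n]} :=
  horner_eval 'X_i \o map_poly (comp_mpoly (vieta n)).

HB.instance Definition _ := GRing.RMorphism.on spec_x.

Local Notation f_r := (\prod_(j < n) ('X - ('X_j : {mpoly rat[n]})%:P)).

Lemma spec_xC c : spec_x c%:P = c \mPo vieta n.
Proof. by rewrite /spec_x /= map_polyC /= /horner_eval hornerC. Qed.

Lemma spec_xX : spec_x 'X = 'X_i.
Proof. by rewrite /spec_x /= map_polyX /= /horner_eval hornerX. Qed.

Lemma spec_Yb : map_poly spec_x (Yb n) = 'X.
Proof. by rewrite map_polyX. Qed.

Lemma spec_Xb : map_poly spec_x (Xb n) = ('X_i)%:P.
Proof. by rewrite map_polyC /= spec_xX. Qed.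

Lemma spec_fbiv q : map_poly spec_x (fbiv q) = f_r \Po map_poly spec_x q.
Proof.
rewrite /fbiv map_comp_poly; congr (_ \Po _); rewrite -map_fgen -map_poly_comp.
by apply: eq_map_poly => c /=; rewrite spec_xC.
Qed.

Lemma spec_f1 : map_poly spec_x (f1 n) = \prod_(j < n | j != i) ('X - ('X_j)%:P).
Proof.
apply: (@split_poly_divided_difference _ _ (fun j => 'X_j)).
have := congr1 (map_poly spec_x) (f1_mul n).
rewrite rmorphM !rmorphB /= !spec_fbiv spec_Yb spec_Xb.
by rewrite comp_polyXr comp_polyCr.
Qed.

Definition spec_xy (j : 'I_n) : {poly {poly Acoef n}} -> {mpoly rat[n]} :=
  horner_eval 'X_j \o map_poly spec_x.

HB.instance Definition _ j := GRing.RMorphism.on (spec_xy j).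

Lemma spec_xyE j p : spec_xy j p = (map_poly spec_x p).['X_j].
Proof. by []. Qed.

Lemma spec_xy_Yb j : spec_xy j (Yb n) = 'X_j.
Proof. by rewrite spec_xyE spec_Yb hornerX. Qed.

Lemma spec_xy_Xb j : spec_xy j (Xb n) = 'X_i.
Proof. by rewrite spec_xyE spec_Xb hornerC. Qed.

Lemma spec_xyC j c : spec_xy j c%:P%:P = c \mPo vieta n.
Proof. by rewrite spec_xyE map_polyC /= hornerC spec_xC. Qed.

Lemma spec_xy_fbiv j q : spec_xy j (fbiv q) = f_r.[spec_xy j q].
Proof. by rewrite spec_xyE spec_fbiv horner_comp. Qed.

Lemma spec_f3 (j : 'I_n) : i != j -> (map_poly spec_x (f3 n)).['X_j] =
  \prod_(k < n | (k != i) && (k != j))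
    (- (2%:R^-1)%:MP * (2%:R * 'X_k - 'X_i - 'X_j)).
Proof.
move=> neq_ij; apply: (@split_poly_midpoint_value _ _ (fun j => 'X_j)) => //.
- exact: mpoly_inv2_mul2.
- by rewrite (inj_eq (@mpolyXU_inj n)).
have := congr1 (spec_xy j) (f3_mul n).
rewrite rmorph_mul_sqrB rmorph_midpoint_difference /= !spec_xy_fbiv.
by rewrite rmorph_mulD /= spec_xy_Yb spec_xy_Xb spec_xyC mpoly_inv2 comp_mpolyC.
Qed.

Lemma spec_f3_scaled (j : 'I_n) : i != j ->
  exists2 c : rat, c != 0 & (map_poly spec_x (f3 n)).['X_j] = c *: D2factor i j.
Proof.
move=> neq_ij; rewrite spec_f3 //; apply: prod_scaled => k _.
exists (- 2%:R^-1) => //; rewrite -mul_mpolyC rmorphN /=; congr (_ * _).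
by rewrite -[in RHS]mul_mpolyC rmorph_nat.
Qed.

End Specialization.

(** * Evaluation of the two resultants *)

Lemma fgen_monic n : fgen n \is monic.
Proof.
rewrite /fgen monicE lead_coefDl ?lead_coefXn // size_polyXn ltnS.
apply: (leq_trans (size_sum _ _ _)); apply/bigmax_leqP => i _.
by rewrite mul_polyC (leq_trans (size_scale_leq _ _)) // size_polyXn.
Qed.

Lemma size_fgen n : size (fgen n) = n.+1.
Proof.
rewrite -(size_map_inj_poly (f := comp_mpoly (vieta n))) ?raddf0 //; last first.
  exact: via_vieta_inj.
rewrite map_fgen.
by rewrite size_prod_XsubC /index_enum -enumT size_enum_ord.
Qed.

(** For [0 < n], $f(y)$ dominates $f(x)$, which is constant in $y$; dividing by the monic $y-x$
    keeps the quotient monic. *)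
Lemma f1_monic n : (0 < n)%N -> f1 n \is monic.
Proof.
move=> n_gt0; have YX_monic : Yb n - Xb n \is monic by exact: monicXsubC.
rewrite -(monicMr _ YX_monic) f1_mul /fbiv.
have fY_monic : map_poly (fun c => c%:P) (fgen n) \is monic.
  by apply: monic_map; apply: fgen_monic.
rewrite comp_polyXr comp_polyCr monicE lead_coefDl -?monicE //.
rewrite size_polyN (leq_ltn_trans (size_polyC_leq1 _)) //.
by rewrite size_map_inj_poly ?size_fgen //; apply: polyC_inj.
Qed.

(** At $x=r_i$, $f_1$ splits over the other roots, so the product formula applies to $F$. *)
Lemma Fres_spec n (i : 'I_n) : exists2 c : rat, c != 0 &
  (map_poly (comp_mpoly (vieta n)) (Fres n)).['X_i] =
    c *: \prod_(j < n | j != i) D2factor i j.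
Proof.
pose rs := [seq ('X_j : {mpoly rat[n]}) | j <- enum 'I_n & j != i].
have uniq_rs : uniq rs.
  by rewrite (map_inj_uniq (@mpolyXU_inj n)) filter_uniq ?enum_uniq.
have f1_split : map_poly (spec_x i) (f1 n) = \prod_(x <- rs) ('X - x%:P).
  by rewrite spec_f1 big_map big_filter big_enum_cond.
have n_gt0 : (0 < n)%N by apply: leq_ltn_trans (ltn_ord i).
have [b] := rmorph_resultant_roots (f3 n) (f1_monic n_gt0) uniq_rs f1_split.
rewrite big_map big_filter big_enum_cond /= => EF.
have [c nz_c Ec] : exists2 c : rat, c != 0 &
    \prod_(j < n | j != i) (map_poly (spec_x i) (f3 n)).['X_j]
      = c *: \prod_(j < n | j != i) D2factor i j.
  by apply: prod_scaled => j neq_ji; apply: spec_f3_scaled; rewrite eq_sym.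
exists ((-1) ^+ b * c); first by rewrite mulf_neq0 ?signr_eq0.
transitivity (spec_x i (Fres n)) => //.
by rewrite EF Ec mulr_sign -scalerA scaler_sign.
Qed.

Theorem theorem3 (n : nat) (hn : (3 <= n)%N) :
  exists D2 : {mpoly rat[n]},
    via_vieta D2 = D2roots n /\
    exists c : rat, c != 0 /\ Eres n = c *: D2 ^+ 2.
Proof.
have [D2 D2E] := via_vieta_sym (D2roots_sym n); exists D2; split => //.
pose rs := [seq ('X_i : {mpoly rat[n]}) | i <- enum 'I_n].
have uniq_rs : uniq rs.
  by rewrite (map_inj_uniq (@mpolyXU_inj n)) enum_uniq.
have f_split :
    map_poly (comp_mpoly (vieta n)) (fgen n) = \prod_(x <- rs) ('X - x%:P).
  by rewrite map_fgen big_map big_enum.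
(* Second use of the product formula, now in $x$ and over all roots of $f$. *)
have [b] := rmorph_resultant_roots (Fres n) (fgen_monic n) uniq_rs f_split.
rewrite big_map big_enum /= => EE.
have [c nz_c Ec] : exists2 c : rat, c != 0 &
    \prod_(i < n) (map_poly (comp_mpoly (vieta n)) (Fres n)).['X_i]
      = c *: \prod_(i < n) \prod_(j < n | j != i) D2factor i j.
  by apply: prod_scaled => i _; apply: Fres_spec.
exists ((-1) ^+ b * c); split; first by rewrite mulf_neq0 ?signr_eq0.
(* Injectivity moves the identity to the ring of the roots. *)
apply: via_vieta_inj; transitivity ((-1) ^+ b * (c *: D2roots n ^+ 2)).
  by rewrite sqr_D2roots -Ec -EE.
rewrite /via_vieta comp_mpolyZ rmorphXn /= -/(via_vieta D2) D2E.
by rewrite mulr_sign -scalerA scaler_sign.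
Qed.
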